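(* Let $K$ be a field which is quadratically closed with respect to $p$, where $p\in K\langle x_1,\dots,x_m\rangle$ is a multilinear polynomial. Then the image of $p$ evaluated on $M_2(K)$ is one of $\{0\}$, $K$ (the scalar matrices), $\operatorname{sl}_2(K)$, or $M_2(K)$.
   Context: A polynomial is multilinear if it has the form $\sum_{\sigma\in S_m}c_\sigma x_{\sigma(1)}\cdots x_{\sigma(m)}$. $K$ is quadratically closed with respect to $p$ if every nonconstant one-variable polynomial over $K$ of degree $\le 2\deg p$ has a root in $K$. $\operatorname{Im} p=\{p(a_1,\dots,a_m):a_i\in M_2(K)\}$, and $\operatorname{sl}_2(K)$ denotes the trace-zero $2\times 2$ matrices. *)

(* Defs.v *)
From HB Require Import structures.
From mathcomp Require Import all_boot all_order all_algebra all_fingroup.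
Set Implicit Arguments. Unset Strict Implicit. Unset Printing Implicit Defensive.
Import GRing.Theory.
Local Open Scope ring_scope.

(* A multilinear polynomial p = \sum_{s in S_m} c_s x_{s(1)} ... x_{s(m)}
   in the free algebra K<x_1,...,x_m> is represented by its coefficient
   family c : 'S_m -> K. *)

Definition mpoly_eval (K : fieldType) (m : nat) (c : 'S_m -> K)
  (a : 'I_m -> 'M[K]_2) : 'M[K]_2 :=
  \sum_(s : 'S_m) c s *: \prod_(i < m) a (s i).

Definition mpoly_image (K : fieldType) (m : nat) (c : 'S_m -> K)
  (A : 'M[K]_2) : Prop :=
  exists a : 'I_m -> 'M[K]_2, mpoly_eval c a = A.

Definition mpoly_deg (K : fieldType) (m : nat) (c : 'S_m -> K) : nat :=
  if [forall s, c s == 0] then 0%N else m.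

Definition quad_closed_wrt (K : fieldType) (m : nat) (c : 'S_m -> K) : Prop :=
  forall q : {poly K}, (1 < size q)%N -> (size q <= (2 * mpoly_deg c).+1)%N ->
    exists x, root q x.

(* Main.v *)
Require Import Defs.
From HB Require Import structures.
From mathcomp Require Import all_boot all_order all_algebra all_fingroup.
From mathcomp Require Import ring.
From Stdlib Require Import Classical_Prop.
(* The field is infinite.  Products of matrices that are each diagonal or
   antidiagonal are diagonal or antidiagonal according to the parity of the
   number of antidiagonal factors, whatever their order.  If some value of p is
   not scalar, then a conjugate of it has a nonzero entry (1,2), and splitting
   the arguments into diagonal and antidiagonal parts yields an antidiagonal
   nonzero value.  Comparing it with its conjugates by the swap and by diagonal
   matrices, and moving one argument at a time, we find two values of p that
   differ in one argument only and span all antidiagonal matrices; their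
   conjugates are all nonscalar matrices of trace 0.  Perturbing this pencil
   towards a value of nonzero trace gives a pencil without scalar matrices in
   which every nonzero trace and every determinant occur together.  Scalar
   matrices come in the same way from tuples with a diagonal value. *)

Set Implicit Arguments. Unset Strict Implicit. Unset Printing Implicit Defensive.
Import GRing.Theory.
Local Open Scope ring_scope.

Definition upd (I : eqType) (T : Type) (a : I -> T) (i : I) (v : T) : I -> T :=
  fun j => if j == i then v else a j.

(** * Polynomial functions of one parameter *)

Definition polyfun (K : fieldType) (f : K -> K) : Prop :=
  exists q : {poly K}, forall t, f t = q.[t].

Definition polymx (K : fieldType) (A : K -> 'M[K]_2) : Prop :=
  forall i j, polyfun (fun t => A t i j).

Section PolynomialFunctions.
Variable K : fieldType.

Lemma polyfun_cst (k : K) : polyfun (fun=> k).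
Proof. by exists k%:P => t; rewrite hornerC. Qed.

Lemma polyfunD (f g : K -> K) :
  polyfun f -> polyfun g -> polyfun (fun t => f t + g t).
Proof. by case=> p fp [q gq]; exists (p + q) => t; rewrite hornerD fp gq. Qed.

Lemma polyfunM (f g : K -> K) :
  polyfun f -> polyfun g -> polyfun (fun t => f t * g t).
Proof. by case=> p fp [q gq]; exists (p * q) => t; rewrite hornerM fp gq. Qed.

Lemma polyfunB (f g : K -> K) :
  polyfun f -> polyfun g -> polyfun (fun t => f t - g t).
Proof.
by case=> p fp [q gq]; exists (p - q) => t; rewrite hornerD hornerN fp gq.
Qed.

Lemma polyfun_sum (I : Type) (r : seq I) (F : I -> K -> K) :
  (forall i, polyfun (F i)) -> polyfun (fun t => \sum_(i <- r) F i t).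
Proof.
move=> polyF; elim: r => [|i r [q IHq]].
  by exists 0 => t; rewrite big_nil horner0.
have [p Fp] := polyF i.
by exists (p + q) => t; rewrite big_cons hornerD Fp IHq.
Qed.

Lemma polyfun_prod (I : Type) (r : seq I) (F : I -> K -> K) :
  (forall i, polyfun (F i)) -> polyfun (fun t => \prod_(i <- r) F i t).
Proof.
move=> polyF; elim: r => [|i r [q IHq]].
  by exists 1 => t; rewrite big_nil hornerC.
have [p Fp] := polyF i.
by exists (p * q) => t; rewrite big_cons hornerM Fp IHq.
Qed.

Lemma polymx_prod (I : Type) (r : seq I) (F : I -> K -> 'M[K]_2) :
  (forall i, polymx (F i)) -> polymx (fun t => \prod_(i <- r) F i t).
Proof.
move=> polyF; elim: r => [|x r IHr] i j.
  by exists ((1 : 'M[K]_2) i j)%:P => t; rewrite big_nil hornerC.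
have [q Hq] : polyfun (fun t => \sum_k F x t i k * (\prod_(y <- r) F y t) k j).
  by apply: polyfun_sum => k; apply: polyfunM; [apply: polyF | apply: IHr].
by exists q => t; rewrite big_cons mxE Hq.
Qed.

Lemma polymx_eval (m : nat) (c : 'S_m -> K) (a : 'I_m -> K -> 'M[K]_2) :
  (forall i, polymx (a i)) -> polymx (fun t => mpoly_eval c (fun i => a i t)).
Proof.
move=> polya i j.
have [q Hq] : polyfun (fun t =>
    \sum_(s : 'S_m) c s * (\prod_(k < m) a (s k) t) i j).
  apply: polyfun_sum => s; apply: polyfunM; first exact: polyfun_cst.
  by apply: polymx_prod => k; apply: polya.
exists q => t; rewrite -Hq /mpoly_eval summxE.
by apply: eq_bigr => s _; rewrite mxE.
Qed.

Lemma polymx_line (A B : 'M[K]_2) : polymx (fun t => A + t *: (B - A)).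
Proof.
move=> i j; exists ((A i j)%:P + 'X * (B i j - A i j)%:P) => t.
by rewrite !mxE !hornerE.
Qed.

Lemma polyfun_trmx (A : K -> 'M[K]_2) :
  polymx A -> polyfun (fun t => \tr (A t)).
Proof. by move=> polyA; apply: polyfun_sum => i; apply: polyA. Qed.

End PolynomialFunctions.

(** * Quadratic equations and generic parameters over [K] *)

Definition quad_closed (K : fieldType) : Prop :=
  forall b c : K, exists x, x ^+ 2 + b * x + c = 0.

(** A nonzero coefficient makes the degree equal to [m], and [0 < m] then lets the bound [2 * m]
    admit monic quadratics. *)
Lemma quad_closed_wrtW (K : fieldType) (m : nat) (c : 'S_m -> K) :
  (0 < m)%N -> [exists s, c s != 0] -> quad_closed_wrt c -> quad_closed K.
Proof.
move=> m_gt0 /existsP[s cs] Kc b d.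
have degc : mpoly_deg c = m.
  by rewrite /mpoly_deg ifN //; apply/forallPn; exists s.
have sz : size ('X^2 + (b *: 'X + d%:P)) = 3%N.
  rewrite size_polyDl size_polyXn // ltnS.
  apply: leq_trans (size_polyD _ _) _; rewrite geq_max.
  rewrite (leq_trans (size_scale_leq _ _)) ?size_polyX //=.
  by rewrite (leq_trans (size_polyC_leq1 _)).
have [||x /rootP] := Kc ('X^2 + (b *: 'X + d%:P)).
- by rewrite sz.
- by rewrite sz degc mul2n; case: (m) m_gt0.
by rewrite !hornerE; exists x.
Qed.

Section Infinite.
Variable K : fieldType.
Hypothesis Kq : quad_closed K.

(* The map [x^2 + x] is onto but identifies [0] and [-1]. *)
Lemma quad_closed_infinite (s : seq K) : exists x, x \notin s.
Proof.
pose s' := undup [:: 0, -1 & s]; pose f (x : K) := x ^+ 2 + x.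
suff [x xs'] : exists x, x \notin s'.
  exists x; apply: contra xs' => xs.
  by rewrite mem_undup !inE xs !orbT.
have [s'f|] := boolP (all (mem (map f s')) s'); last first.
  case/allPn => y ys' yNf; have [x] := Kq 1 (- y).
  rewrite mul1r => /eqP; rewrite subr_eq0 => /eqP fx.
  by exists x; apply: contra yNf => xs'; rewrite -fx; apply: map_f.
have s'0 : 0 \in s' by rewrite mem_undup inE eqxx.
have s'1 : -1 \in rem 0 s'.
  rewrite mem_rem_uniq ?undup_uniq // !inE oppr_eq0 oner_eq0 /=.
  by rewrite mem_undup !inE eqxx orbT.
have sub : {subset s' <= map f (rem 0 s')}.
  move=> y /(allP s'f) /mapP[x xs' ->].
  have [->|x0] := eqVneq x 0.
    have -> : f 0 = f (-1) by rewrite /f; ring.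
    exact: map_f.
  by apply: map_f; rewrite mem_rem_uniq ?undup_uniq // !inE x0.
have := uniq_leq_size (undup_uniq _) sub.
rewrite size_map size_rem // -ltnS prednK ?ltnn //.
by case: (s') s'0.
Qed.

Lemma uniq_seq_of_size (n : nat) : exists2 s : seq K, uniq s & size s = n.
Proof.
elim: n => [|n [s s_uniq s_n]]; first by exists [::].
have [x xs] := quad_closed_infinite s.
by exists (x :: s) => /=; rewrite ?xs ?s_n.
Qed.

(** Two generic conditions are met at once: the product of the two polynomials is nonzero, and an
    infinite field has a point outside its roots. *)
Lemma polyfun_nz2 (f g : K -> K) (a b : K) :
  polyfun f -> polyfun g -> f a != 0 -> g b != 0 ->
  exists t, (f t != 0) && (g t != 0).
Proof.
case=> p fp [q gq]; rewrite fp gq => pa qb.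
have p0 : p != 0 by apply: contraNneq pa => ->; rewrite horner0.
have q0 : q != 0 by apply: contraNneq qb => ->; rewrite horner0.
have [s s_uniq s_n] := uniq_seq_of_size (size (p * q)).
have [sr|/allPn[t _ rt]] := boolP (all (root (p * q)) s).
  have := max_poly_roots _ sr s_uniq.
  by rewrite mulf_neq0 // s_n ltnn => /(_ isT).
by exists t; rewrite fp gq; move: rt; rewrite rootE hornerM mulf_eq0 negb_or.
Qed.

End Infinite.

(** * Multilinearity of evaluation and closure of the image under conjugation *)

Section Multilinear.
Variables (K : fieldType) (m : nat) (c : 'S_m -> K).
Local Notation ev := (mpoly_eval c).

Lemma eq_eval (a b : 'I_m -> 'M[K]_2) : a =1 b -> ev a = ev b.
Proof.
move=> ab; apply: eq_bigr => s _; congr (_ *: _).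
by apply: eq_bigr => i _; rewrite ab.
Qed.

Lemma prod_linear1 (I : eqType) (r : seq I) (F G H : I -> 'M[K]_2)
    (i0 : I) (x y : K) :
    uniq r -> i0 \in r -> F i0 = x *: G i0 + y *: H i0 ->
    (forall i, i != i0 -> F i = G i /\ F i = H i) ->
  \prod_(i <- r) F i = x *: \prod_(i <- r) G i + y *: \prod_(i <- r) H i.
Proof.
elim: r => // i r IHr /= /andP[ir ur]; rewrite inE !big_cons => i0r F0 FGH.
have [ii0|ii0] := eqVneq i i0.
  subst i0; have off j : j \in r -> j != i by apply: contraTneq => ->.
  have -> : \prod_(j <- r) F j = \prod_(j <- r) G j.
    by apply: eq_big_seq => j /off/FGH[].
  have <- : \prod_(j <- r) G j = \prod_(j <- r) H j.
    by apply: eq_big_seq => j /off/FGH[<- <-].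
  by rewrite F0 mulrDl !scalerAl.
have {i0r} i0r : i0 \in r by move: i0r; rewrite eq_sym (negPf ii0).
rewrite (IHr ur i0r F0 FGH) mulrDr -!scalerAr.
by have [<- <-] := FGH _ ii0.
Qed.

(** Each monomial contains the argument [i] exactly once, at position [s^-1 i]. *)
Lemma eval_linear1 (a : 'I_m -> 'M[K]_2) (i : 'I_m) (u v : 'M[K]_2) (x y : K) :
  ev (upd a i (x *: u + y *: v)) = x *: ev (upd a i u) + y *: ev (upd a i v).
Proof.
rewrite /mpoly_eval !scaler_sumr -big_split; apply: eq_bigr => s _ /=.
rewrite 2!scalerA ![_ * c s]mulrC -!scalerA -scalerDr; congr (_ *: _).
apply: (@prod_linear1 _ _ _ _ _ ((s^-1)%g i)).
- exact: index_enum_uniq.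
- exact: mem_index_enum.
- by rewrite /upd permKV eqxx.
move=> j; rewrite -(inj_eq (@perm_inj _ s)) permKV => /negPf ji.
by rewrite /upd ji.
Qed.

Lemma upd_self (a : 'I_m -> 'M[K]_2) (i : 'I_m) : upd a i (a i) =1 a.
Proof. by move=> j; rewrite /upd; case: eqP => [->|]. Qed.

Lemma imageZ (A : 'M[K]_2) (k : K) :
  (0 < m)%N -> mpoly_image c A -> mpoly_image c (k *: A).
Proof.
move=> m0 [a <-]; pose i := Ordinal m0.
exists (upd a i (k *: a i + 0 *: a i)).
by rewrite eval_linear1 scale0r addr0 (eq_eval (upd_self a i)).
Qed.

Lemma image0 : (0 < m)%N -> mpoly_image c 0.
Proof.
move=> m0; rewrite -(scale0r (ev (fun=> 0))).
by apply: imageZ => //; exists (fun=> 0).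
Qed.

Lemma eval_conj (a : 'I_m -> 'M[K]_2) (P : 'M[K]_2) :
  P \in unitmx -> ev (fun i => P *m a i *m invmx P) = P *m ev a *m invmx P.
Proof.
move=> Pu; rewrite /mpoly_eval mulmx_sumr mulmx_suml; apply: eq_bigr => s _.
rewrite -scalemxAr -scalemxAl; congr (_ *: _).
elim: (index_enum _) => [|i r IHr].
  by rewrite !big_nil mulmx1 mulmxV.
rewrite !big_cons IHr -!mulmxE !mulmxA; congr (_ *m _).
by rewrite -!mulmxA (mulKmx Pu).
Qed.

Lemma image_conj (A P : 'M[K]_2) :
  P \in unitmx -> mpoly_image c A -> mpoly_image c (P *m A *m invmx P).
Proof. by move=> Pu [a <-]; eexists; apply: eval_conj. Qed.

End Multilinear.

(** * Conjugacy, traces and determinants of 2 x 2 matrices *)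

Section TwoByTwo.
Variable K : fieldType.
Implicit Types A B P : 'M[K]_2.

Definition mx2 (x y z w : K) : 'M[K]_2 :=
  \matrix_(i, j) if i == 0 then (if j == 0 then x else y)
                 else (if j == 0 then z else w).

Definition det2 A : K := A 0 0 * A 1 1 - A 0 1 * A 1 0.

Lemma ord2P (i : 'I_2) : i = 0 \/ i = 1.
Proof. by case: i => [[|[|//]] Hi]; [left | right]; apply: val_inj. Qed.

Lemma eq_mx2 A B :
  A 0 0 = B 0 0 -> A 0 1 = B 0 1 -> A 1 0 = B 1 0 -> A 1 1 = B 1 1 -> A = B.
Proof.
move=> e00 e01 e10 e11; apply/matrixP => i j.
by case: (ord2P i) => ->; case: (ord2P j) => ->.
Qed.

Lemma mulmx2E A B i j : (A *m B) i j = A i 0 * B 0 j + A i 1 * B 1 j.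
Proof.
rewrite mxE big_ord_recl big_ord1.
by congr (_ + A i _ * B _ j); apply: val_inj.
Qed.

Lemma trmx2E A : \tr A = A 0 0 + A 1 1.
Proof.
by rewrite /mxtrace big_ord_recl big_ord1; congr (_ + A _ _); apply: val_inj.
Qed.

Lemma mx2_unit (x y z w : K) : x * w - y * z != 0 -> mx2 x y z w \in unitmx.
Proof.
set d := _ - _ => d0.
apply: (proj1 (@mulmx1_unit _ _ _ (mx2 (w / d) (- y / d) (- z / d) (x / d)) _)).
by apply: eq_mx2; rewrite mulmx2E !mxE /=; rewrite /d; field.
Qed.

Definition companion2 (t d : K) : 'M[K]_2 := mx2 0 1 (- d) t.

(** The rows of [P] are a vector v and vA, so the relation is Cayley-Hamilton. If (1,0), (0,1) and
    (1,1) were all eigenvectors, [A] would be scalar; one of them therefore makes [P] invertible. *)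
Lemma companion2_conj A : ~~ is_scalar_mx A ->
  exists2 P, P \in unitmx & P *m A = companion2 (\tr A) (det2 A) *m P.
Proof.
move=> nsA; rewrite trmx2E.
pose P x y := mx2 x y (x * A 0 0 + y * A 1 0) (x * A 0 1 + y * A 1 1).
have PA x y : P x y *m A = companion2 (A 0 0 + A 1 1) (det2 A) *m P x y.
  by apply: eq_mx2; rewrite !mulmx2E !mxE /= /det2; ring.
have [A01|A01] := eqVneq (A 0 1) 0; last first.
  exists (P 1 0); rewrite ?PA //; apply: mx2_unit.
  by rewrite !(mul1r, mul0r) addr0 subr0.
have [A10|A10] := eqVneq (A 1 0) 0; last first.
  exists (P 0 1); rewrite ?PA //; apply: mx2_unit.
  by rewrite !(mul1r, mul0r) !add0r oppr_eq0.
exists (P 1 1); rewrite ?PA //; apply: mx2_unit.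
rewrite !mul1r A01 A10 add0r addr0 subr_eq0; apply: contra nsA => /eqP e.
apply/is_scalar_mxP; exists (A 0 0).
by apply: eq_mx2; rewrite !mxE //= e.
Qed.

(* The trace of [W - k U], with [k = tr W / tr U], is zero, so adding multiples
   of it to [U] only changes the determinant; the polar form and the
   determinant of this direction do not both vanish because the discriminant
   of [det2] on the pencil is nonzero. *)
Lemma exists_pencil_tr_det (U W : 'M[K]_2) (t d : K) :
    quad_closed K -> t != 0 -> \tr U != 0 ->
    U 0 1 * W 1 0 - W 0 1 * U 1 0 != 0 ->
    (U 0 0 * W 1 1 + W 0 0 * U 1 1 - U 0 1 * W 1 0 - W 0 1 * U 1 0) ^+ 2
      - 4%:R * det2 U * det2 W != 0 ->
  exists x y, [/\ ~~ is_scalar_mx (x *: U + y *: W),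
    \tr (x *: U + y *: W) = t & det2 (x *: U + y *: W) = d].
Proof.
set P := _ - _ - _ => Kq t0 U0 M0 D0.
pose k := \tr W / \tr U; pose l := t / \tr U.
have l0 : l != 0 by rewrite mulf_neq0 ?invr_eq0.
(* [dV] and [bV] are the coefficients of s^2 and s in the determinant of
   [l *: U + s *: (W - k *: U)], whose trace is [t] for every s. *)
pose dV := det2 W - k * P + k ^+ 2 * det2 U; pose bV := l * (P - 2%:R * k * det2 U).
have [s es] : exists s, dV * s ^+ 2 + bV * s + l ^+ 2 * det2 U = d.
  have [dV0|dV0] := eqVneq dV 0; last first.
    have [s es] := Kq (bV / dV) ((l ^+ 2 * det2 U - d) / dV); exists s.
    apply/eqP; rewrite -subr_eq0; apply/eqP.
    by rewrite -[RHS](mulr0 dV) -es; field.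
  have bV0 : bV != 0.
    apply: contraNneq D0 => /eqP; rewrite mulf_eq0 (negPf l0) subr_eq0 => /eqP eP.
    have -> : det2 W = k * P - k ^+ 2 * det2 U.
      by apply/eqP; rewrite -subr_eq0 -dV0 /dV; apply/eqP; ring.
    by rewrite eP; apply/eqP; ring.
  by exists ((d - l ^+ 2 * det2 U) / bV); rewrite dV0; field.
exists (l - s * k), s; have trA : \tr ((l - s * k) *: U + s *: W) = t.
  by rewrite linearD !linearZ /= /l /k; field.
split=> //.
  (* By [M0], vanishing off-diagonal entries force [s = 0]; then [U] itself has none, against
     [M0]. *)
  apply/negP => /is_scalar_mxP[r] /matrixP e.
  have := e 0 1; have := e 1 0; rewrite !mxE /= => e10 e01.
  have s0 : s = 0.
    apply: (mulIf M0); rewrite mul0r.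
    transitivity (U 0 1 * ((l - s * k) * U 1 0 + s * W 1 0)
               - U 1 0 * ((l - s * k) * U 0 1 + s * W 0 1)); first by ring.
    by rewrite e10 e01; ring.
  move: M0; rewrite s0 !mulr0n !mul0r !addr0 subr0 in e10 e01.
  move/eqP: e10; move/eqP: e01.
  rewrite !mulf_eq0 !invr_eq0 (negPf t0) (negPf U0) /= => /eqP-> /eqP->.
  by rewrite mul0r mulr0 subrr eqxx.
by rewrite -es /dV /bV /P /det2 !mxE; ring.
Qed.

Lemma companion2_nonscalar (t d : K) : ~~ is_scalar_mx (companion2 t d).
Proof.
apply/is_scalar_mxP => -[k /matrixP/(_ 0 1)].
by rewrite !mxE /= => /eqP; rewrite oner_eq0.
Qed.
End TwoByTwo.

(** * The grading by diagonal and antidiagonal matrices *)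

Section Parity.
Variable K : fieldType.
Implicit Types A B : 'M[K]_2.

(** [false] stands for diagonal and [true] for antidiagonal, so that [addb] gives the parity of a
    product. *)
Definition parity_mx (b : bool) A : Prop :=
  forall i j, (i != j) != b -> A i j = 0.

Lemma parity_mx1 : parity_mx false 1.
Proof. by move=> i j; rewrite mxE; case: (i == j). Qed.

Lemma parity_mxM (b b' : bool) A B :
  parity_mx b A -> parity_mx b' B -> parity_mx (b (+) b') (A * B).
Proof.
move=> Ab Bb i j ij; rewrite -mulmxE mulmx2E.
suff H k : A i k * B k j = 0 by rewrite !H addr0.
have [ik|/Ab->] := eqVneq (i != k) b; last by rewrite mul0r.
have [kj|/Bb->] := eqVneq (k != j) b'; last by rewrite mulr0.
by move: ij; rewrite -ik -kj; case: (ord2P i) => ->; case: (ord2P j) => ->;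
   case: (ord2P k) => ->.
Qed.

Lemma parity_mxD (b : bool) A B :
  parity_mx b A -> parity_mx b B -> parity_mx b (A + B).
Proof. by move=> Ab Bb i j ij; rewrite mxE Ab ?Bb ?addr0. Qed.

Lemma parity_mxZ (b : bool) (k : K) A : parity_mx b A -> parity_mx b (k *: A).
Proof. by move=> Ab i j ij; rewrite mxE Ab ?mulr0. Qed.

Lemma parity_mx_line (b : bool) A B (t : K) :
  parity_mx b A -> parity_mx b B -> parity_mx b (A + t *: (B - A)).
Proof.
move=> Ab Bb; apply: parity_mxD => //; apply/parity_mxZ/parity_mxD => //.
by rewrite -scaleN1r; apply: parity_mxZ.
Qed.

Lemma parity_mx_split A : exists B C,
  [/\ A = B + C, parity_mx false B & parity_mx true C].
Proof.
exists (mx2 (A 0 0) 0 0 (A 1 1)), (mx2 0 (A 0 1) (A 1 0) 0); split.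
- by apply: eq_mx2; rewrite !mxE /= ?addr0 ?add0r.
- by move=> i j; rewrite mxE; case: (ord2P i) => ->; case: (ord2P j) => ->.
- by move=> i j; rewrite mxE; case: (ord2P i) => ->; case: (ord2P j) => ->.
Qed.

(** All monomials have the same parity, because permuting the factors does not change the sum of
    their parities. *)
Lemma parity_mx_eval (m : nat) (c : 'S_m -> K) (e : 'I_m -> bool)
    (a : 'I_m -> 'M[K]_2) :
  (forall i, parity_mx (e i) (a i)) ->
  parity_mx (\big[addb/false]_i e i) (mpoly_eval c a).
Proof.
move=> ea; apply: big_ind => [i j _|A B|s _]; first by rewrite mxE.
  exact: parity_mxD.
apply: parity_mxZ; rewrite (reindex_inj (@perm_inj _ s)) /=.
apply: (big_ind2 parity_mx) => [|b A b' B Ab Bb|i _].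
- exact: parity_mx1.
- exact: parity_mxM.
- exact: ea.
Qed.

End Parity.

(** * Pencils of values that differ in one argument *)

Section Image.
Variables (K : fieldType) (m : nat) (c : 'S_m -> K).
Local Notation ev := (mpoly_eval c).

Lemma pencil_image (z : 'I_m -> 'M[K]_2) (n : 'I_m) (v : 'M[K]_2) (x y : K) :
  mpoly_image c (x *: ev z + y *: ev (upd z n v)).
Proof.
exists (upd z n (x *: z n + y *: v)).
by rewrite eval_linear1 (eq_eval c (upd_self z n)).
Qed.

(** Cramer's rule: two entries of a pencil with nonzero minor can be prescribed. *)
Lemma pencil_image_entries (z : 'I_m -> 'M[K]_2) (n : 'I_m) (v : 'M[K]_2)
    (i j k l : 'I_2) (b : bool) (x y : K) :
    parity_mx b (ev z) -> parity_mx b (ev (upd z n v)) ->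
    ev z i j * ev (upd z n v) k l != ev (upd z n v) i j * ev z k l ->
  exists A, [/\ mpoly_image c A, parity_mx b A, A i j = x & A k l = y].
Proof.
set U := ev z; set V := ev (upd z n v); rewrite -subr_eq0 => Ub Vb d0.
pose d := U i j * V k l - V i j * U k l.
eexists; split.
- exact: (pencil_image z n v ((x * V k l - y * V i j) / d)
                       ((y * U i j - x * U k l) / d)).
- by apply: parity_mxD; apply: parity_mxZ.
- by rewrite !mxE -/U -/V /d; field.
- by rewrite !mxE -/U -/V /d; field.
Qed.

Lemma nonscalar_image (A B : 'M[K]_2) :
    ~~ is_scalar_mx A -> ~~ is_scalar_mx B -> \tr A = \tr B ->
    det2 A = det2 B -> mpoly_image c A -> mpoly_image c B.
Proof.
move=> /companion2_conj[P Pu PA] /companion2_conj[Q Qu QB] tAB dAB.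
move=> /(image_conj Pu); rewrite PA tAB dAB mulmxK //.
have Qu' : invmx Q \in unitmx by rewrite unitmx_inv.
by move=> /(image_conj Qu'); rewrite invmxK -mulmxA -QB mulKmx.
Qed.

(** Splitting one argument at a time writes the value as a sum of two; by additivity [L] is nonzero
    on one of them. *)
Lemma exists_parity_tuple (L : 'M[K]_2 -> K) (a : 'I_m -> 'M[K]_2) :
    (forall A B, L (A + B) = L A + L B) -> L (ev a) != 0 ->
  exists e : 'I_m -> bool, exists2 b, forall i, parity_mx (e i) (b i)
                                    & L (ev b) != 0.
Proof.
move=> LD La; suff: forall n, (n <= m)%N -> exists e : 'I_m -> bool,
    exists2 b, forall i : 'I_m, (i < n)%N -> parity_mx (e i) (b i)
             & L (ev b) != 0.
  by case/(_ m (leqnn m)) => e [b be Lb]; exists e, b => // i; apply: be.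
elim=> [|n IHn] nm; first by exists xpredT, a.
have [e [b be Lb]] := IHn (ltnW nm); pose o := Ordinal nm.
have [B [C [bo Bp Cp]]] := parity_mx_split (b o).
have evb : ev b = ev (upd b o B) + ev (upd b o C).
  rewrite -(scale1r (ev (upd b o B))) -(scale1r (ev (upd b o C))).
  by rewrite -eval_linear1 !scale1r -bo (eq_eval c (upd_self b o)).
have ind (f : bool) (D : 'M[K]_2) : parity_mx f D -> L (ev (upd b o D)) != 0 ->
    exists e : 'I_m -> bool,
    exists2 b, forall i : 'I_m, (i < n.+1)%N -> parity_mx (e i) (b i)
             & L (ev b) != 0.
  move=> Df LD0; exists (upd e o f), (upd b o D) => // i.
  rewrite /upd ltnS leq_eqVlt => ltin; case: eqVneq => // io; apply: be.
  by case/predU1P: ltin => // eqin; case/eqP: io; apply: val_inj.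
have [B0|] := eqVneq (L (ev (upd b o B))) 0; last exact: ind Bp.
by apply: (ind _ _ Cp); move: Lb; rewrite evb LD B0 add0r.
Qed.

Hypothesis Kq : quad_closed K.

(* Along the line from [a] to [b], moved one coordinate at a time, the ratio of
   the two entries would be constant if no single move changed it; this holds
   at a generic point of the line, hence everywhere. *)
Lemma exists_independent_pencil (H : 'I_m -> 'M[K]_2 -> Prop)
    (a b : 'I_m -> 'M[K]_2) (i j k l : 'I_2) :
    (forall n A B t, H n A -> H n B -> H n (A + t *: (B - A))) ->
    (forall n, H n (a n)) -> (forall n, H n (b n)) ->
    ev a i j * ev b k l != ev b i j * ev a k l ->
  exists z n v, [/\ forall n, H n (z n), H n v
    & ev z i j * ev (upd z n v) k l != ev (upd z n v) i j * ev z k l].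
Proof.
move=> HL; wlog a0 : a b / ev a i j != 0 => [hwlog|] Ha Hb ab.
  have [a0|a0] := eqVneq (ev a i j) 0; last exact: (hwlog a b).
  have b0 : ev b i j != 0.
    by apply: contraNneq ab => b0; rewrite a0 b0 !mul0r.
  by apply: (hwlog b a) => //; rewrite eq_sym.
pose h n t (o : 'I_m) := if (o < n)%N then a o + t *: (b o - a o) else a o.
have polyh n : polymx (fun t => ev (h n t)).
  apply: (@polymx_eval _ _ c (fun o t => h n t o)) => o; rewrite /h.
  case: (o < n)%N; first exact: polymx_line.
  by move=> ? ?; apply: polyfun_cst.
have h0 t : ev (h 0 t) = ev a by apply: eq_eval.
have hm1 : ev (h m 1) = ev b.
  by apply: eq_eval => o; rewrite /h ltn_ord scale1r addrC subrK.
have hn0 n : ev (h n 0) = ev a.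
  by apply: eq_eval => o; rewrite /h; case: ifP; rewrite ?scale0r ?addr0.
(* In [h n t] the first [n] arguments have moved. The product keeps the entry (i, j) nonzero at all
   [m.+1] stages, so that equal ratios can be chained by cancellation. *)
have [||||t] := @polyfun_nz2 _ Kq
   (fun t => ev a i j * ev (h m t) k l - ev (h m t) i j * ev a k l)
   (fun t => \prod_(n <- iota 0 m.+1) ev (h n t) i j) 1 0.
- by apply: polyfunB; apply: polyfunM; (exact: polyfun_cst) || exact: polyh.
- by apply: polyfun_prod => n; apply: polyh.
- by rewrite hm1 subr_eq0.
- by rewrite prodf_seq_neq0; apply/allP => n _; rewrite hn0.
case/andP; rewrite subr_eq0 prodf_seq_neq0 => mt /allP nt.
have /existsP[n ndep] : [exists n : 'I_m,
    ev (h n t) i j * ev (h n.+1 t) k l != ev (h n.+1 t) i j * ev (h n t) k l].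
  apply: contraNT mt; rewrite negb_exists => /forallP dep.
  suff: forall n, (n <= m)%N ->
      ev a i j * ev (h n t) k l = ev (h n t) i j * ev a k l by move->.
  elim=> [|n IHn] nm; first by rewrite h0.
  have n0 : ev (h n t) i j != 0 by apply: nt; rewrite mem_iota /= add0n ltnS ltnW.
  apply: (mulfI n0); move: (dep (Ordinal nm)); rewrite negbK => /eqP /= e.
  rewrite mulrCA e [RHS]mulrCA -IHn ?(ltnW nm) //; ring.
exists (h n t), n, (a n + t *: (b n - a n)).
have -> : ev (upd (h n t) n (a n + t *: (b n - a n))) = ev (h n.+1 t).
  apply: eq_eval => o; rewrite /upd /h ltnS (leq_eqVlt o).
  have [->|] := eqVneq o n; first by rewrite eqxx.
  by rewrite -(inj_eq val_inj) /= => /negPf->.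
split=> //; last exact: HL.
by move=> o; rewrite /h; case: ifP => // _; apply: HL.
Qed.

(** * Pencils from conjugate tuples, and the matrices they reach *)

Hypothesis m_gt0 : (0 < m)%N.

Definition swap2 : 'M[K]_2 := mx2 0 1 1 0.

Lemma swap2_unit : swap2 \in unitmx.
Proof. by apply: mx2_unit; rewrite mul0r mul1r sub0r oppr_eq0 oner_eq0. Qed.

Lemma swap2_conj (A : 'M[K]_2) :
  swap2 *m A *m invmx swap2 = mx2 (A 1 1) (A 1 0) (A 0 1) (A 0 0).
Proof.
apply: (canLR (mulmxK swap2_unit)).
by apply: eq_mx2; rewrite !mulmx2E !mxE /=; ring.
Qed.

Lemma diag_conj (r : K) (A : 'M[K]_2) : r != 0 ->
  mx2 1 0 0 r *m A *m invmx (mx2 1 0 0 r)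
    = mx2 (A 0 0) (A 0 1 / r) (A 1 0 * r) (A 1 1).
Proof.
move=> r0; apply: canLR (mulmxK _) _.
  by apply: mx2_unit; rewrite mul1r mul0r subr0.
by apply: eq_mx2; rewrite !mulmx2E !mxE /=; field.
Qed.

(** Used for conjugation by the swap and by diagonal matrices, which never mixes diagonal with
    antidiagonal entries. *)
Lemma parity_mx2 (b : bool) (A : 'M[K]_2) (x y z w : K) :
  parity_mx b A -> (A 0 0 = 0 -> A 1 1 = 0 -> x = 0 /\ w = 0) ->
  (A 0 1 = 0 -> A 1 0 = 0 -> y = 0 /\ z = 0) -> parity_mx b (mx2 x y z w).
Proof.
move=> Ab xw yz.
have dg : true != b -> y = 0 /\ z = 0 by move=> tb; apply: yz; apply: Ab.
have od : false != b -> x = 0 /\ w = 0 by move=> tb; apply: xw; apply: Ab.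
by move=> i j; rewrite mxE; case: (ord2P i) => ->; case: (ord2P j) => -> /=;
  first [case/od | case/dg].
Qed.

(* Swapping the basis gives [f^2 = g^2] for the two antidiagonal entries if
   there is no independent pencil, and rescaling it by [r] gives
   [r^2 = 1] unless [f g = 0]. *)
Lemma antidiag_pencil (A : 'M[K]_2) :
    mpoly_image c A -> ~~ is_scalar_mx A ->
  exists z n v, [/\ parity_mx true (ev z), parity_mx true (ev (upd z n v)) &
    ev z 0 1 * ev (upd z n v) 1 0 != ev (upd z n v) 0 1 * ev z 1 0].
Proof.
(* Passing to the companion matrix makes the entry (0, 1) equal to 1; this entry also forces the
   split tuple to be odd. *)
move=> /[swap] nsA /(nonscalar_image nsA (companion2_nonscalar _ _)).
move=> /(_ (\tr A) (det2 A)) [||a aC].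
- by rewrite [RHS]trmx2E !mxE /= add0r.
- by rewrite [RHS]/det2 !mxE /= mul0r sub0r mul1r opprK.
have [||e [b be b01]] := @exists_parity_tuple (fun M => M 0 1) a.
- by move=> M N; rewrite mxE.
- by rewrite aC mxE /= oner_eq0.
have e_odd : \big[addb/false]_i e i.
  by apply: contraNT b01 => /negPf ef; rewrite (parity_mx_eval c be) // ef.
have evP d : (forall i, parity_mx (e i) (d i)) -> parity_mx true (ev d).
  by move=> /(parity_mx_eval c); rewrite e_odd.
have [y ye yb] : exists2 y, forall i, parity_mx (e i) (y i) &
    ev b 0 1 * ev y 1 0 != ev y 0 1 * ev b 1 0.
  pose y P i := P *m b i *m invmx P.
  have [e2|] := eqVneq (ev b 0 1 * ev b 0 1) (ev b 1 0 * ev b 1 0); last first.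
    exists (y swap2) => [o|].
      rewrite /y swap2_conj; apply: (parity_mx2 (be o)) => // -> -> //.
    by rewrite eval_conj ?swap2_unit // swap2_conj !mxE.
  have [r] := quad_closed_infinite Kq [:: 0; 1; -1].
  rewrite !inE !negb_or => /and3P[r0 r1 rN1].
  have Du : mx2 1 0 0 r \in unitmx by apply: mx2_unit; rewrite mul1r mul0r subr0.
  exists (y (mx2 1 0 0 r)) => [o|].
    rewrite /y diag_conj //; apply: (parity_mx2 (be o)) => -> -> //.
    by rewrite !mul0r.
  rewrite eval_conj // diag_conj // !mxE /=.
  have b10 : ev b 1 0 != 0.
    by apply: contraNneq b01 => b10; rewrite -[_ == 0]orbb -mulf_eq0 e2 b10 mulr0.
  rewrite -subr_eq0.
  have -> : ev b 0 1 * (ev b 1 0 * r) - ev b 0 1 / r * ev b 1 0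
     = ev b 0 1 * ev b 1 0 * ((r - 1) * (r + 1)) / r by field.
  by rewrite !mulf_neq0 ?invr_eq0 // ?subr_eq0 // -[1]opprK subr_eq0.
have HL n (M N : 'M[K]_2) t : parity_mx (e n) M -> parity_mx (e n) N ->
   parity_mx (e n) (M + t *: (N - M)) by apply: parity_mx_line.
have [z [n [v [ze ve zv]]]] := exists_independent_pencil (H := fun n => parity_mx (e n)) HL be ye yb.
exists z, n, v; split=> //; apply: evP => // i.
by rewrite /upd; case: eqP => [->|].
Qed.

(* An even tuple with value [diag(x, y)] either has [x = y], or, with its
   swapped copy, yields a pencil of all diagonal matrices. *)
Lemma even_tuple_scalar_image (b : 'I_m -> 'M[K]_2) (e : 'I_m -> bool) :
    (forall i, parity_mx (e i) (b i)) -> parity_mx false (ev b) ->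
    ev b 0 0 + ev b 1 1 != 0 -> mpoly_image c 1%:M.
Proof.
move=> be b_even b0.
have [b01 b10] : ev b 0 1 = 0 /\ ev b 1 0 = 0 by split; apply: b_even.
have [bxy|bxy] := eqVneq (ev b 0 0) (ev b 1 1).
  have x0 : ev b 0 0 != 0 by apply: contraNneq b0; rewrite -bxy => ->; rewrite addr0.
  have -> : 1%:M = (ev b 0 0)^-1 *: ev b.
    by apply: eq_mx2; rewrite !mxE ?b01 ?b10 -?bxy ?mulr0 ?mulVf.
  by apply: imageZ => //; exists b.
have e_even : (\big[addb/false]_i e i) = false.
  apply: contraNF b0 => e_odd.
  have := parity_mx_eval c be; rewrite e_odd => bo.
  by rewrite !bo ?addr0.
have evP d : (forall i, parity_mx (e i) (d i)) -> parity_mx false (ev d).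
  by move=> /(parity_mx_eval c); rewrite e_even.
pose y o := swap2 *m b o *m invmx swap2.
have ye o : parity_mx (e o) (y o).
  by rewrite /y swap2_conj; apply: (parity_mx2 (be o)) => -> ->.
have HL n (M N : 'M[K]_2) t : parity_mx (e n) M -> parity_mx (e n) N ->
   parity_mx (e n) (M + t *: (N - M)) by apply: parity_mx_line.
have yb : ev b 0 0 * ev y 1 1 != ev y 0 0 * ev b 1 1.
  rewrite eval_conj ?swap2_unit // swap2_conj !mxE /= -!expr2 -subr_eq0 subr_sqr.
  by rewrite mulf_neq0 // subr_eq0.
have [z [n [v [ze ve zv]]]] := exists_independent_pencil (H := fun n => parity_mx (e n)) HL be ye yb.
have [||A [Ai A_even A00 A11]] := pencil_image_entries 1 1 _ _ zv (b := false).
- exact: evP.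
- by apply: evP => i; rewrite /upd; case: eqP => [->|].
suff <- : A = 1%:M by [].
by apply: eq_mx2; rewrite !mxE /= ?A00 ?A11 // A_even.
Qed.

(** The antidiagonal matrix with entries 1 and [- det2 B] lies in the pencil and has the trace and
    determinant of [B]. *)
Lemma trace0_image (A B : 'M[K]_2) :
    mpoly_image c A -> ~~ is_scalar_mx A -> ~~ is_scalar_mx B -> \tr B = 0 ->
  mpoly_image c B.
Proof.
move=> Ai nsA nsB trB.
have [z [n [v [zo vo zv]]]] := antidiag_pencil Ai nsA.
have [C [Ci C_odd C01 C10]] := pencil_image_entries 1 (- det2 B) zo vo zv.
have C00 : C 0 0 = 0 by apply: C_odd.
have C11 : C 1 1 = 0 by apply: C_odd.
apply: nonscalar_image Ci => //; last first.
- by rewrite /(det2 C) C01 C10 C00 mul0r sub0r mul1r opprK.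
- by rewrite trB trmx2E C00 C11 addr0.
apply/is_scalar_mxP => -[k /matrixP/(_ 0 1)].
by rewrite C01 !mxE /= => /eqP; rewrite oner_eq0.
Qed.

(* The antidiagonal pencil is moved towards a tuple whose value has nonzero
   trace; for generic parameter it stays free of scalar matrices. *)
Lemma trace_neq0_image (A X B : 'M[K]_2) :
    mpoly_image c A -> ~~ is_scalar_mx A -> mpoly_image c X -> \tr X != 0 ->
    ~~ is_scalar_mx B -> \tr B != 0 ->
  mpoly_image c B.
Proof.
move=> Ai nsA [x xX] trX nsB trB.
have [z [n [v [zo vo zv]]]] := antidiag_pencil Ai nsA.
pose a t o := z o + t *: (x o - z o).
pose U t := ev (a t); pose W t := ev (upd (a t) n v).
have polyU i j : polyfun (fun t => U t i j).
  exact: (polymx_eval c (fun o => polymx_line (z o) (x o))).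
have polyW i j : polyfun (fun t => W t i j).
  apply: (@polymx_eval _ _ c (fun o t => upd (a t) n v o)) => o; rewrite /upd.
  by case: (o == n) => [? ?|]; [apply: polyfun_cst | apply: polymx_line].
have U0 : U 0 = ev z by apply: eq_eval => o; rewrite /a scale0r addr0.
have U1 : U 1 = X by rewrite -xX; apply: eq_eval => o; rewrite /a scale1r addrC subrK.
have W0 : W 0 = ev (upd z n v).
  by apply: eq_eval => o; rewrite /upd /a scale0r addr0.
pose M t := U t 0 1 * W t 1 0 - W t 0 1 * U t 1 0.
pose D t := (U t 0 0 * W t 1 1 + W t 0 0 * U t 1 1 - U t 0 1 * W t 1 0
   - W t 0 1 * U t 1 0) ^+ 2 - 4%:R * det2 (U t) * det2 (W t).
have M0 : M 0 != 0 by rewrite /M U0 W0 subr_eq0.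
(* At parameter 0 both matrices are antidiagonal, and the discriminant of the determinant is the
   square of the minor. *)
have D0 : D 0 = M 0 ^+ 2.
  rewrite /D /M U0 W0 /det2 (zo 0 0) // (zo 1 1) // (vo 0 0) // (vo 1 1) //; ring.
have polyM : polyfun M.
  by do ?[exact: polyU | exact: polyW | apply: polyfunB | apply: polyfunM].
have polyD : polyfun D.
  by rewrite /D /det2; do ?[exact: polyU | exact: polyW | exact: polyfun_cst |
    apply: polyfunB | apply: polyfunD | apply: polyfunM].
have [||||t] := polyfun_nz2 Kq (f := fun t => \tr (U t)) (g := fun t => M t * D t)
  (a := 1) (b := 0).
- exact: polyfun_trmx.
- exact: polyfunM.
- by rewrite U1.
- by rewrite D0 mulf_neq0 // expf_neq0.
case/andP=> trU; rewrite mulf_eq0 negb_or => /andP[Mt Dt].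
have [p [q [ns tr det]]] := exists_pencil_tr_det (det2 B) Kq trB trU Mt Dt.
exact: (nonscalar_image ns nsB tr det (pencil_image _ _ _ _ _)).
Qed.
End Image.

(** * Case distinction: zero, scalar, traceless or arbitrary values *)

Theorem theorem2p2 (K : fieldType) (m : nat) (c : 'S_m -> K) :
  (0 < m)%N ->
  quad_closed_wrt c ->
  (forall A : 'M[K]_2, mpoly_image c A <-> A = 0)
  \/ (forall A : 'M[K]_2, mpoly_image c A <-> exists k : K, A = k%:M)
  \/ (forall A : 'M[K]_2, mpoly_image c A <-> \tr A = 0)
  \/ (forall A : 'M[K]_2, mpoly_image c A).
Proof.
move=> m_gt0 Kc; have i0 := image0 c m_gt0.
have [c0|] := boolP [exists s, c s != 0]; last first.
  rewrite negb_exists => /forallP c0; left=> A; split=> [[a <-]|->] //.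
  by apply: big1 => s _; move: (c0 s); rewrite negbK => /eqP->; rewrite scale0r.
have {Kc c0} Kq := quad_closed_wrtW m_gt0 c0 Kc.
have [[A [Ai nsA]]|sc] := classic (exists A, mpoly_image c A /\ ~~ is_scalar_mx A);
    last first.
  have {}sc A : mpoly_image c A -> is_scalar_mx A.
    by move=> Ai; apply: contraT => nsA; case: sc; exists A.
  have [[A [Ai A0]]|z] := classic (exists A, mpoly_image c A /\ A != 0); last first.
    left=> A; split=> [Ai|-> //]; apply/eqP; apply: contraT => A0.
    by case: z; exists A.
  right; left=> B; split=> [/sc/is_scalar_mxP //|[k ->]].
  have /is_scalar_mxP[l Al] := sc _ Ai.
  have l0 : l != 0 by apply: contraNneq A0 => l0; rewrite Al l0 raddf0.
  have -> : k%:M = (k / l) *: A by rewrite Al scale_scalar_mx mulfVK.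
  exact: imageZ.
right; right.
have [[X [Xi trX]]|tr0] := classic (exists X, mpoly_image c X /\ \tr X != 0).
  right=> B; have [/is_scalar_mxP[k ->]|nsB] := boolP (is_scalar_mx B); last first.
    have [trB|trB] := eqVneq (\tr B) 0; first exact: (trace0_image Kq Ai).
    exact: (trace_neq0_image Kq Ai nsA Xi).
  rewrite -scalemx1; apply: imageZ => //.
  case: Xi => x xX; rewrite -xX in trX.
  (* The trace is additive, so it survives the splitting; being nonzero, it makes the new tuple
     even. *)
  have [e [b be trb]] := exists_parity_tuple (@mxtraceD _ _) trX.
  rewrite trmx2E in trb.
  apply: (even_tuple_scalar_image Kq m_gt0 be) => //.
  have := parity_mx_eval c be; case: (\big[addb/false]_i e i) => // b_odd.
  by rewrite !b_odd ?addr0 ?eqxx in trb.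
have {}tr0 X : mpoly_image c X -> \tr X = 0.
  by move=> Xi; apply/eqP; apply: contraT => trX; case: tr0; exists X.
left=> B; split=> [/tr0 //|trB].
have [/is_scalar_mxP[k Bk]|nsB] := boolP (is_scalar_mx B); last first.
  exact: (trace0_image Kq Ai).
(* A nonzero scalar matrix has zero trace only in characteristic 2. *)
have [k0|k0] := eqVneq k 0; first by rewrite Bk k0 raddf0.
have k2 : 2%:R = 0 :> K.
  apply: (mulfI k0); rewrite mulr0 -trB Bk trmx2E !mxE /=; ring.
(* This traceless nonscalar matrix has nonzero entry (0, 0), which yields a nonzero diagonal value.
   Its trace is 0, so in characteristic 2 its diagonal entries agree and it is scalar. *)
have [||a aN] := @trace0_image _ _ c Kq A (mx2 1 1 (- 1) (- 1)) Ai nsA.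
- apply/is_scalar_mxP => -[l /matrixP/(_ 0 1)].
  by rewrite !mxE /= => /eqP; rewrite oner_eq0.
- by rewrite trmx2E !mxE /= subrr.
have [||e [b be b00]] := @exists_parity_tuple _ _ c (fun M => M 0 0) a.
- by move=> M N; rewrite mxE.
- by rewrite aN mxE /= oner_eq0.
have b_even : parity_mx false (mpoly_eval c b).
  have := parity_mx_eval c be; case: (\big[addb/false]_i e i) => // b_odd.
  by rewrite b_odd ?eqxx in b00.
have b11 : mpoly_eval c b 1 1 = mpoly_eval c b 0 0.
  have /eqP := tr0 _ (ex_intro _ b erefl); rewrite trmx2E addrC addr_eq0 => /eqP->.
  rewrite -[RHS]subr0 -(mul0r (mpoly_eval c b 0 0)) -k2; ring.
have -> : B = (k / mpoly_eval c b 0 0) *: mpoly_eval c b.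
  by apply: eq_mx2; rewrite Bk !mxE /= ?b11 ?(b_even 0 1) ?(b_even 1 0) ?mulr0 ?divfK.
by apply: imageZ => //; exists b.
Qed.
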